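(* Let $\hat{K}=[0,1]^3$. An element $\hat{\sigma}\in\Sigma(\hat{K})$ is uniquely determined by the following degrees of freedom: (1) for all $i<j$ in $\{1,2,3\}$, with $k\notin\{i,j\}$, and each of the four edges of $\hat K$ given by $x_i\in\{0,1\}$, $x_j\in\{0,1\}$: the integrals over that edge $\int \hat{\sigma}_{ij}\,\hat{v}$ for $\hat{v}\in\mathrm{span}\{1,x_k\}$ (24 degrees of freedom); (2) for each $i\in\{1,2,3\}$, with $\{l,k\}=\{1,2,3\}\setminus\{i\}$, and each of the two faces $x_i=0$ and $x_i=1$ of $\hat K$: the integrals over that face $\int \hat{\sigma}_{ii}\,\hat{v}$ for $\hat{v}\in\mathcal{P}_{1,1}(x_l,x_k)$ (24 degrees of freedom); (3) for all $i<j$ in $\{1,2,3\}$, with $k\notin\{i,j\}$, each $l\in\{i,j\}$, and each of the two faces $x_l=0$ and $x_l=1$ of $\hat K$: the integrals over that face $\int \hat{\sigma}_{ij}\,\hat{v}$ for $\hat{v}\in\mathrm{span}\{1,x_k\}$ (24 degrees of freedom); (4) for all $i<j$ in $\{1,2,3\}$, with $k\notin\{i,j\}$: the integrals $\int_{\hat{K}}\hat{\sigma}_{ij}\,\hat{v}\,dx$ for $\hat{v}\in\mathrm{span}\{1,x_k\}$ (6 degrees of freedom).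
   Context: $\mathcal{P}_{k_1,k_2,k_3}$ (also written $\mathcal{P}_{k_1k_2k_3}$) denotes the space of real polynomials in $(x_1,x_2,x_3)$ of degree at most $k_1$ in $x_1$, at most $k_2$ in $x_2$ and at most $k_3$ in $x_3$. $\mathcal{P}_{1,1}(x_l,x_k)$ denotes the space of polynomials in the variables $x_l,x_k$ of degree at most $1$ in each. $\mathbb{S}$ denotes the space of real symmetric $3\times3$ matrices, and the divergence $\operatorname{div}\tau$ of a matrix field $\tau$ is taken row-wise. For a brick $K\subset\mathbb{R}^3$ with edges parallel to the coordinate axes, $\Sigma(K)$ is the space of symmetric matrix fields $\tau=(\tau_{ij})_{i,j=1}^3:K\to\mathbb{S}$ such that $\tau_{11}\in\mathcal{P}_{3,1,1}$, $\tau_{22}\in\mathcal{P}_{1,3,1}$, $\tau_{33}\in\mathcal{P}_{1,1,3}$, $\tau_{12}=\tau_{21}\in\mathcal{P}_{2,2,1}$, $\tau_{13}=\tau_{31}\in\mathcal{P}_{2,1,2}$, $\tau_{23}=\tau_{32}\in\mathcal{P}_{1,2,2}$, and $\operatorname{div}\tau\in\mathcal{P}_{0,1,1}\times\mathcal{P}_{1,0,1}\times\mathcal{P}_{1,1,0}$. *)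

(* Defs.v *)
From HB Require Import structures.
From mathcomp Require Import all_boot all_order all_algebra.
From mathcomp Require Import all_classical all_reals all_analysis.
From mathcomp Require mpoly.
(* mpoly's notations clash with those of MathComp-Analysis. *)
Import -(notations) mpoly.

Set Implicit Arguments.
Unset Strict Implicit.
Unset Printing Implicit Defensive.

Import Order.TTheory GRing.Theory Num.Theory.

Local Open Scope classical_set_scope.
Local Open Scope ring_scope.

(* The coordinates x_1, x_2, x_3 are indexed by 0, 1, 2 : 'I_3.
   A polynomial field on K is an element of mpoly 3 R rather than a function:
   K has nonempty interior, so both notions of polynomial agree on K. *)

Definition deg_le (R : realType) (d : 'I_3 -> nat) (p : mpoly 3 R) : Prop :=
  forall m, m \in msupp p -> forall i : 'I_3, (m i <= d i)%N.

Definition Pspace (R : realType) (k1 k2 k3 : nat) : mpoly 3 R -> Prop :=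
  deg_le (tnth [tuple k1; k2; k3]).

Definition divergence (R : realType) (tau : 'M[mpoly 3 R]_3) (i : 'I_3) :
    mpoly 3 R :=
  \sum_(j < 3) mderiv j (tau i j).

Record Sigma (R : realType) (tau : 'M[mpoly 3 R]_3) : Prop := MkSigma {
  Sigma_sym : tau^T = tau;
  Sigma_11 : Pspace 3 1 1 (tau 0 0);
  Sigma_22 : Pspace 1 3 1 (tau 1 1);
  Sigma_33 : Pspace 1 1 3 (tau 2 2);
  Sigma_12 : Pspace 2 2 1 (tau 0 1);
  Sigma_13 : Pspace 2 1 2 (tau 0 2);
  Sigma_23 : Pspace 1 2 2 (tau 1 2);
  Sigma_div1 : Pspace 0 1 1 (divergence tau 0);
  Sigma_div2 : Pspace 1 0 1 (divergence tau 1);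
  Sigma_div3 : Pspace 1 1 0 (divergence tau 2) }.

(* Integral over the edge x_i = a, x_j = b of the unit cube (i != j). *)
Definition edge_integral (R : realType) (i j : 'I_3) (a b : bool)
    (f : ('I_3 -> R) -> R) : R :=
  \int[@lebesgue_measure R]_(t in `[0, 1])
     f (fun l => if l == i then a%:R else if l == j then b%:R else t).

(* Integral over the face x_i = a; [unlift i] numbers the two other
   coordinates 0 and 1. *)
Definition face_integral (R : realType) (i : 'I_3) (a : bool)
    (f : ('I_3 -> R) -> R) : R :=
  \int[(@lebesgue_measure R \x @lebesgue_measure R)%E]_(
      p in `[0, 1] `*` `[0, 1])
     f (fun l => if unlift i l is Some m
                 then if m == ord0 then p.1 else p.2
                 else a%:R).

Definition cube_integral (R : realType) (f : ('I_3 -> R) -> R) : R :=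
  \int[(@lebesgue_measure R \x @lebesgue_measure R \x @lebesgue_measure R)%E]_(
      p in `[0, 1] `*` `[0, 1] `*` `[0, 1])
     f (tnth [tuple p.1.1; p.1.2; p.2]).

Inductive dof : Type :=
  | EdgeDof of 'I_3 & 'I_3 & bool & bool  (* i j a b: edge x_i = a, x_j = b *)
  | NormalDof of 'I_3 & bool              (* i a: face x_i = a *)
  | ShearDof of 'I_3 & 'I_3 & 'I_3 & bool (* i j l a: face x_l = a *)
  | CellDof of 'I_3 & 'I_3.               (* i j *)

Definition admissible (s : dof) : bool :=
  match s with
  | EdgeDof i j _ _ => (i < j)%N
  | NormalDof _ _ => true
  | ShearDof i j l _ => (i < j)%N && (l \in [:: i; j])
  | CellDof i j => (i < j)%N
  end.

(* v lies in span{1, x_k}, where k is the index outside {i, j}. *)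
Definition span_1x (R : realType) (i j : 'I_3) (v : mpoly 3 R) : Prop :=
  exists (k : 'I_3) (c d : R),
    [/\ k != i, k != j & v = mpolyC 3 c + d *: mpolyX R (mnm1 k)].

Definition test_space (R : realType) (s : dof) : mpoly 3 R -> Prop :=
  match s with
  | EdgeDof i j _ _ => span_1x i j
  | NormalDof i _ => (* P_{1,1} in the coordinates other than x_i *)
      deg_le (fun l => if l == i then 0%N else 1%N)
  | ShearDof i j _ _ => span_1x i j
  | CellDof i j => span_1x i j
  end.

Definition moment (R : realType) (s : dof) (sigma : 'M[mpoly 3 R]_3)
    (v : mpoly 3 R) : R :=
  match s with
  | EdgeDof i j a b =>
      edge_integral i j a b (fun x => meval x (sigma i j) * meval x v)
  | NormalDof i a =>
      face_integral i a (fun x => meval x (sigma i i) * meval x v)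
  | ShearDof i j l a =>
      face_integral l a (fun x => meval x (sigma i j) * meval x v)
  | CellDof i j =>
      cube_integral (fun x => meval x (sigma i j) * meval x v)
  end.

(* Main.v *)
From HB Require Import structures.
Require Import Defs.
From mathcomp Require Import all_boot all_order all_algebra.
From mathcomp Require Import all_classical all_reals all_analysis.
From mathcomp Require Import measurable_realfun.
From mathcomp Require Import ring lra zify.
From mathcomp Require mpoly.
Import -(notations) mpoly.
Import Order.TTheory GRing.Theory Num.Theory.
Import numFieldNormedType.Exports.

(** Every degree of freedom is a tensor product of functionals of one variable.
    Integrating a polynomial over an edge, a face or the cube, against a
    monomial weight, amounts to applying in each coordinate an endpoint value, a
    mean or a first moment; [tensor_form phi] is the linear form that takes the
    monomial with exponents m_i to the product of the phi_i(m_i), and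
    [edge_integral_meval], [face_integral_meval] and [cube_integral_meval] are
    Fubini together with the integral of a power over the unit interval.

    In one variable p(0), p(1) and the mean determine a quadratic, and the mean
    and first moment determine an affine function.  Adding the coefficients of
    the powers above the permitted degree gives four independent functionals on
    cubics, and the degree bound becomes the vanishing of the added data.  A
    tensor product of invertible matrices is invertible, with inverse the tensor
    product of the inverses; so tensor data of such families determine a
    polynomial ([tensor_form_inj]), can be prescribed freely ([interpP]), and
    detect degrees ([small_degree]).

    For i < j, the component sigma_ij in P_2(x_i) P_2(x_j) P_1(x_k) has
    3 * 3 * 2 = 18 tensor data, which are exactly its 8 edge, 8 face and 2 cell
    moments.  So the off-diagonal components are determined by their moments and
    can be chosen freely, before the divergence condition enters.

    The diagonal component sigma_ii in P_3(x_i) P_1 P_1 has 16 tensor data when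
    the direction i carries the two endpoint values and the coefficients of x_i^2
    and x_i^3.  The endpoint values give the 8 face moments.  The other 8 data
    are fixed by the condition that the i-th divergence be constant in x_i: for
    k = 1, 2 the coefficient of x_i^k in d_i sigma_ii, which is k+1 times that of
    x_i^(k+1) in sigma_ii, must cancel that of the already known off-diagonal
    derivatives ([div_form_divergence]).  This gives uniqueness in
    [Sigma_unique] and the explicit solution [stress_field]. *)

Set Implicit Arguments.
Unset Strict Implicit.
Unset Printing Implicit Defensive.

Local Open Scope classical_set_scope.
Local Open Scope ring_scope.

(** * Fubini for products of functions *)

Section SigmaFiniteProduct.
Local Open Scope ereal_scope.
Context d1 d2 (T1 : measurableType d1) (T2 : measurableType d2) (R : realType).
Variable m1 : {sigma_finite_measure set T1 -> \bar R}.
Variable m2 : {sigma_finite_measure set T2 -> \bar R}.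

(** A named copy of the product measure, which carries a sigma-finite structure.
    The cube integral is taken against a product whose first factor is itself a
    product, and Fubini needs both factors to be sigma-finite. *)
Definition sigma_finite_prod := (m1 \x m2)%E.

HB.instance Definition _ := measure_function.Measure.on sigma_finite_prod.

Let sigma_finite_sigma_finite_prod : sigma_finite setT sigma_finite_prod.
Proof.
have /sigma_finiteP[F [covF ndF Foo]] := sigma_finiteT m1.
have /sigma_finiteP[G [covG ndG Goo]] := sigma_finiteT m2.
exists (fun n => F n `*` G n) => [|n]; last first.
  have [mF Fn] := Foo n; have [mG Gn] := Goo n.
  split; first exact: measurableX.
  rewrite /sigma_finite_prod product_measure1E //.
  by rewrite lte_mul_pinfty // ge0_fin_numE.
apply/esym/seteqP; split=> // -[x y] _.
have [i _ Fx] : (\bigcup_k F k) x by rewrite -covF.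
have [j _ Gy] : (\bigcup_k G k) y by rewrite -covG.
exists (maxn i j) => //; split.
  by have /subsetPset := ndF _ _ (leq_maxl i j); apply.
by have /subsetPset := ndG _ _ (leq_maxr i j); apply.
Qed.

HB.instance Definition _ :=
  Measure_isSigmaFinite.Build _ _ _
    sigma_finite_prod sigma_finite_sigma_finite_prod.
End SigmaFiniteProduct.

Section ProductIntegral.
Context (d1 d2 : measure_display) (T1 : measurableType d1)
  (T2 : measurableType d2) (R : realType).
Variable m1 : {sigma_finite_measure set T1 -> \bar R}.
Variable m2 : {sigma_finite_measure set T2 -> \bar R}.
Variables (A : set T1) (B : set T2) (f : T1 -> R) (g : T2 -> R).
Hypothesis mA : measurable A.
Hypothesis mB : measurable B.
Hypothesis intf : m1.-integrable A (EFin \o f).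
Hypothesis intg : m2.-integrable B (EFin \o g).

Let F := f \_ A.
Let G := g \_ B.

Let patchM : (fun p => f p.1 * g p.2) \_ (A `*` B) = fun p => F p.1 * G p.2.
Proof.
apply/funext => -[x y]; rewrite /F /G !patchE in_setX /=.
by case: (x \in A); case: (y \in B); rewrite /= ?mul0r ?mulr0.
Qed.

Let intF : m1.-integrable setT (EFin \o F).
Proof. by rewrite /F -restrict_EFin; apply/(integrable_mkcond _ mA). Qed.

Let intG : m2.-integrable setT (EFin \o G).
Proof. by rewrite /G -restrict_EFin; apply/(integrable_mkcond _ mB). Qed.

Let mFG : measurable_fun setT (fun p : T1 * T2 => F p.1 * G p.2).
Proof.
have /measurable_EFinP mF := measurable_int _ intF.
have /measurable_EFinP mG := measurable_int _ intG.
by apply: measurable_funM; apply: measurableT_comp.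
Qed.

Let intFG : (m1 \x m2)%E.-integrable setT (fun p => (F p.1 * G p.2)%:E).
Proof.
apply/(integrable12ltyP _ _ _).2; first exact/measurable_EFinP.
have intG' := integrable_abse intG.
have absFG x y : (`|(F (x, y).1 * G (x, y).2)%:E| =
  `|(F x)%:E| * `|(G y)%:E|)%E by rewrite EFinM abseM.
under eq_integral => x _.
  under eq_integral => y _ do rewrite absFG.
  rewrite ge0_integralZl //; [|by have := measurable_int _ intG'].
  over.
rewrite /= ge0_integralZr //; [|by have := measurable_int _ (integrable_abse intF)
  |exact: integral_ge0].
rewrite lte_mul_pinfty//.
- exact: integral_ge0.
- by rewrite (integrable_fin_num _ (integrable_abse intF)).
- by have /integrableP[] := intG.
Qed.

Lemma integrable_prodM :
  (m1 \x m2)%E.-integrable (A `*` B) (EFin \o (fun p => f p.1 * g p.2)).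
Proof.
apply/integrable_mkcond; first exact: measurableX.
by rewrite restrict_EFin patchM.
Qed.

Lemma Rintegral_prodM :
  \int[(m1 \x m2)%E]_(p in A `*` B) (f p.1 * g p.2) =
  (\int[m1]_(x in A) f x) * (\int[m2]_(y in B) g y).
Proof.
rewrite Rintegral_mkcond patchM (Rintegral_mkcond _ A) (Rintegral_mkcond _ B).
rewrite -/F -/G /Rintegral -(integral12_prod_meas1 intFG) /fubini_F /=.
under eq_integral => x _.
  under eq_integral => y _ do rewrite EFinM.
  rewrite integralZl //.
  over.
have Gfin : (\int[m2]_x (G x)%:E)%E \is a fin_num.
  exact: (integrable_fin_num _ intG).
rewrite /= -{1}(fineK Gfin) integralZr // fineM //.
exact: (integrable_fin_num _ intF).
Qed.
End ProductIntegral.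

(** * Integration of polynomials *)

Section LinearIntegral.
Context (d : measure_display) (T : measurableType d) (R : realType)
  (mu : {measure set T -> \bar R}) (D : set T).
Hypothesis mD : measurable D.

Lemma integrable_scale (c : R) (h : T -> R) :
  mu.-integrable D (EFin \o h) -> mu.-integrable D (EFin \o (fun x => c * h x)).
Proof.
move=> inth; rewrite (_ : _ \o _ = fun x => (c%:E * (EFin \o h) x)%E) //.
exact: integrableZl.
Qed.

Lemma Rintegral_sum (I : Type) (s : seq I) (h : I -> T -> R) :
  (forall i, mu.-integrable D (EFin \o h i)) ->
  \int[mu]_(x in D) (\sum_(i <- s) h i x) = \sum_(i <- s) \int[mu]_(x in D) h i x.
Proof.
move=> inth.
have inths r : mu.-integrable D (EFin \o (fun x => \sum_(i <- r) h i x)).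
  rewrite /comp; under eq_fun do rewrite -sumEFin.
  by apply: integrable_sum => // i _; apply: inth.
elim: s => [|i s IH].
  under eq_Rintegral => x _ do rewrite big_nil.
  by rewrite big_nil Rintegral_cst // mul0r.
under eq_Rintegral => x _ do rewrite big_cons.
by rewrite big_cons RintegralD // IH.
Qed.
End LinearIntegral.

Lemma integrable_exprn (R : realType) n :
  (@lebesgue_measure R).-integrable `[0, 1] (EFin \o (fun x => x ^+ n)).
Proof.
apply: continuous_compact_integrable; first exact: segment_compact.
by apply: continuous_in_subspaceT => x _; exact: exprn_continuous.
Qed.

Lemma Rintegral_exprn (R : realType) n :
  \int[lebesgue_measure]_(x in `[0, 1]) (x ^+ n) = n.+1%:R^-1 :> R.
Proof.
pose F (y : R) := n.+1%:R^-1 *: y ^+ n.+1.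
have dF (x : R) : is_derive x 1 F (x ^+ n).
  have -> : F = n.+1%:R^-1 \*: (@GRing.exp (R -> R) id n.+1).
    by apply/funext => y; rewrite /F /= exprfctE.
  by apply: is_derive_eq; rewrite /= /GRing.scale /=; field.
have cF (x : R) : F y @[y --> x] --> F x.
  by apply: differentiable_continuous; apply/derivable1_diffP.
rewrite /Rintegral (@continuous_FTC2 _ _ F) //=.
- by rewrite /F expr1n expr0n /= scaler0 subr0 /GRing.scale /= mulr1.
- by apply: continuous_in_subspaceT => x _; exact: exprn_continuous.
- by split=> [x _||];
    [exact: ex_derive | exact: cvg_at_right_filter | exact: cvg_at_left_filter].
- by move=> x _; rewrite derive1E; exact: derive_val.
Qed.

(** * Tensor products of one-variable functionals *)

Section TensorForm.
Context (R : realType) (n : nat).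
Implicit Types (phi psi : 'I_n -> nat -> R) (p q : mpoly n R) (m : multinom n).

(** The tensor product of the functionals [phi i], a functional of one variable
    being given by its values on the powers of the variable. *)
Definition tensor_form phi p : R :=
  \sum_(m <- msupp p) mcoeff m p * \prod_(i < n) phi i (m i).

(** Summing over a range of monomials independent of [p] makes the form visibly
    linear in [p]. *)
Lemma tensor_formwE k phi p : (msize p <= k)%N ->
  tensor_form phi p =
  \sum_(m : bmultinom n k) mcoeff m p * \prod_(i < n) phi i (m i).
Proof.
move=> le_pk; rewrite /tensor_form (ssrcomplements.big_mksub (bmultinom n k)) //=.
- by rewrite big_rmcond //= => m /memN_msupp_eq0 ->; rewrite mul0r.
- by rewrite msupp_uniq.
- by move=> m /msize_mdeg_lt /leq_trans; apply.
Qed.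

Lemma tensor_form_is_scalar phi : scalar (tensor_form phi).
Proof.
move=> c p q; pose k := maxn (msize (c *: p + q)) (maxn (msize p) (msize q)).
rewrite !(@tensor_formwE k) ?leq_max ?leqnn ?orbT // mulr_sumr -big_split /=.
by apply: eq_bigr => m _; rewrite mcoeffD mcoeffZ mulrDl mulrA.
Qed.

HB.instance Definition _ phi := GRing.isLinear.Build R (mpoly n R) R _
  (tensor_form phi) (tensor_form_is_scalar phi).

Lemma tensor_formX phi m :
  tensor_form phi (mpolyX R m) = \prod_(i < n) phi i (m i).
Proof. by rewrite /tensor_form msuppX big_seq1 mcoeffX eqxx mul1r. Qed.

(** A monomial weight is absorbed by shifting each functional, so moments
    against monomials are again tensor forms. *)
Lemma tensor_formMX phi p m :
  tensor_form phi (p * mpolyX R m) =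
  tensor_form (fun i k => phi i (k + m i)%N) p.
Proof.
rewrite {1}(mpolyE p) mulr_suml linear_sum; apply: eq_bigr => m' _.
rewrite -scalerAl linearZ -mpolyXD /= tensor_formX; congr (_ * _).
by apply: eq_bigr => i _; rewrite mnmDE.
Qed.

Lemma eq_tensor_form phi psi :
  (forall i, phi i =1 psi i) -> tensor_form phi =1 tensor_form psi.
Proof.
move=> E p; apply: eq_bigr => m _; congr (_ * _).
by apply: eq_bigr => i _; rewrite E.
Qed.
End TensorForm.

(** * The three kinds of integrals as tensor forms *)

Section Moments.
Context (R : realType).

Definition eval_form (a : bool) : nat -> R := fun k => a%:R ^+ k.
Definition int_form : nat -> R := fun k => k.+1%:R^-1.

(** By linearity, an integral of polynomials along a parametrized piece [X] of
    space is a tensor form as soon as it factors on monomials. *)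
Lemma Rintegral_meval (n : nat) (d : measure_display) (T : measurableType d)
    (mu : {measure set T -> \bar R}) (D : set T) (X : T -> 'I_n -> R)
    (phi : 'I_n -> nat -> R) (p : mpoly n R) :
  measurable D ->
  (forall m : multinom n,
     mu.-integrable D (EFin \o (fun t => \prod_i X t i ^+ m i)) /\
     \int[mu]_(t in D) (\prod_i X t i ^+ m i) = \prod_i phi i (m i)) ->
  \int[mu]_(t in D) meval (X t) p = tensor_form phi p.
Proof.
move=> mD intX.
under eq_Rintegral => t _ do rewrite mevalE.
have intcX m : mu.-integrable D
    (EFin \o (fun t => mcoeff m p * \prod_i X t i ^+ m i)).
  by apply: integrable_scale => //; case: (intX m).
rewrite Rintegral_sum //; apply: eq_bigr => m _.
by have [im <-] := intX m; rewrite RintegralZl.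
Qed.

Local Notation mu := (@lebesgue_measure R).

Let square : set (R * R) := `[0, 1] `*` `[0, 1].

Let msquare : measurable (square : set (measurableTypeR R * measurableTypeR R)).
Proof. by apply: measurableX. Qed.

Let mI : measurable (`[0, 1] : set (measurableTypeR R)).
Proof. exact: measurable_itv. Qed.

Let integrable_square a b : (mu \x mu)%E.-integrable square
  (EFin \o (fun t => t.1 ^+ a * t.2 ^+ b)).
Proof.
exact: (@integrable_prodM _ _ _ _ _ mu mu _ _ _ _ mI mI
  (integrable_exprn R a) (integrable_exprn R b)).
Qed.

Let Rintegral_square a b : \int[(mu \x mu)%E]_(t in square)
  (t.1 ^+ a * t.2 ^+ b) = int_form a * int_form b.
Proof.
rewrite (@Rintegral_prodM _ _ _ _ _ mu mu _ _ _ _ mI mI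
  (integrable_exprn R a) (integrable_exprn R b)).
by rewrite !Rintegral_exprn.
Qed.

Lemma edge_integral_meval (i j : 'I_3) (a b : bool) (p : mpoly 3 R) :
  i != j ->
  edge_integral i j a b (fun x => meval x p) =
  tensor_form (fun l => if l == i then eval_form a
                        else if l == j then eval_form b else int_form) p.
Proof.
move=> ij; apply: Rintegral_meval => // m.
(* [k] is the index outside {i, j}. *)
pose k := lift i (lift (odflt ord0 (unlift i j)) ord0).
have prodE (F : 'I_3 -> R) : \prod_l F l = F i * (F j * F k).
  rewrite (bigD1_ord i) // /k; case: (unlift_some ij) => j' -> -> /=.
  by rewrite (bigD1_ord j') // big_ord1.
have ji : j == i = false by apply/negbTE; rewrite eq_sym.
have ki : k == i = false by apply/negbTE; rewrite eq_sym neq_lift.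
have kj : k == j = false.
  rewrite /k; case: (unlift_some ij) => j' -> -> /=.
  by apply/negbTE; rewrite (inj_eq lift_inj) eq_sym neq_lift.
rewrite prodE eqxx ji eqxx ki kj.
have E : (fun t : R => \prod_l (if l == i then a%:R else if l == j then b%:R
    else t) ^+ m l) = fun t => (a%:R ^+ m i * b%:R ^+ m j) * t ^+ m k.
  apply/funext => t; rewrite prodE eqxx ji.
  by rewrite eqxx ki kj mulrA.
have int_t := @integrable_exprn R (m k).
rewrite E; split; last first.
  by rewrite RintegralZl // Rintegral_exprn mulrA.
exact: integrable_scale.
Qed.

Lemma face_integral_meval (i : 'I_3) (a : bool) (p : mpoly 3 R) :
  face_integral i a (fun x => meval x p) =
  tensor_form (fun l => if l == i then eval_form a else int_form) p.
Proof.
apply: Rintegral_meval; first exact: msquare.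
move=> m; set j := lift i ord0; set k := lift i (@ord_max 1).
have prodE (F : 'I_3 -> R) : \prod_l F l = F i * (F j * F k).
  rewrite (bigD1_ord i) // 2!big_ord_recr big_ord0 /= mul1r.
  by congr (_ * (F _ * F _)); apply: val_inj.
have E : (fun t : R * R => \prod_l (if unlift i l is Some m
      then if m == ord0 then t.1 else t.2 else a%:R) ^+ m l) =
    fun t => a%:R ^+ m i * (t.1 ^+ m j * t.2 ^+ m k).
  by apply/funext => t; rewrite prodE unlift_none !liftK.
rewrite E prodE eqxx !(eq_sym _ i) !(negbTE (neq_lift _ _)); split.
  exact: integrable_scale.
by rewrite RintegralZl // Rintegral_square.
Qed.

Lemma cube_integral_meval (p : mpoly 3 R) :
  cube_integral (fun x => meval x p) = tensor_form (fun=> int_form) p.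
Proof.
apply: Rintegral_meval; first exact: measurableX.
move=> m.
have E : (fun t : R * R * R =>
      \prod_l (tnth [tuple t.1.1; t.1.2; t.2] l) ^+ m l) =
    fun t => (t.1.1 ^+ m 0 * t.1.2 ^+ m 1) * t.2 ^+ m 2.
  apply/funext => t; rewrite !big_ord_recl big_ord0 mulr1 -mulrA.
  by congr (_ ^+ m _ * (_ ^+ m _ * _ ^+ m _)); apply: val_inj.
rewrite E; split.
  exact: (@integrable_prodM _ _ _ _ _ (sigma_finite_prod mu mu) mu
    _ _ _ _ msquare mI
    (integrable_square (m 0) (m 1)) (integrable_exprn R (m 2))).
have -> := @Rintegral_prodM _ _ _ _ _ (sigma_finite_prod mu mu) mu
    _ _ _ _ msquare mI
    (integrable_square (m 0) (m 1)) (integrable_exprn R (m 2)).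
rewrite Rintegral_square Rintegral_exprn !big_ord_recl big_ord0 mulr1 -mulrA.
by congr (_ * (_ * _)); congr (_ (m _)); apply: val_inj.
Qed.
End Moments.

(** * Tensor products of unisolvent families *)

Section Unisolvence.
Context (R : realType) (n N : nat).
Implicit Types (Lam : 'I_n -> nat -> nat -> R) (p q : mpoly n R)
  (alpha d : 'I_n -> nat) (f g : {ffun 'I_n -> 'I_N}).

Definition mnm_ffun f : multinom n := Multinom [tuple (f i : nat) | i < n].

Lemma mnm_ffunE f i : mnm_ffun f i = f i.
Proof. exact: mnmE. Qed.

Lemma mnm_ffun_inj : injective mnm_ffun.
Proof.
by move=> f g /mnmP fg; apply/ffunP => i; apply: val_inj; have := fg i;
  rewrite !mnm_ffunE.
Qed.

Definition boxed p : Prop := forall m, m \in msupp p -> forall i, (m i < N)%N.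

Lemma ffun_of_small alpha : (forall i, (alpha i < N)%N) ->
  exists f, forall i, f i = alpha i :> nat.
Proof.
by move=> h; exists [ffun i => Ordinal (h i)] => i; rewrite ffunE.
Qed.

Lemma boxedE p : boxed p ->
  p = \sum_f mcoeff (mnm_ffun f) p *: mpolyX R (mnm_ffun f).
Proof.
move=> bp; apply/mpolyP => m; rewrite linear_sum /=.
under eq_bigr do rewrite mcoeffZ mcoeffX.
have [m_in|m_out] := boolP (m \in msupp p).
  have [f fE] := ffun_of_small (bp m m_in).
  have -> : m = mnm_ffun f by apply/mnmP => i; rewrite mnm_ffunE fE.
  rewrite (bigD1 f) //= eqxx mulr1 big1 ?addr0 // => g gf.
  by rewrite (inj_eq mnm_ffun_inj) (negbTE gf) mulr0.
rewrite (memN_msupp_eq0 m_out) big1 // => f _.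
by case: eqP => [->|_]; rewrite ?mulr0 // (memN_msupp_eq0 m_out) mul0r.
Qed.

(** Generalized Vandermonde matrix: rows are the functionals of direction [i],
    columns the monomials. *)
Definition gram Lam i : 'M[R]_N := \matrix_(a, l) Lam i a l.
Definition unisolvent Lam := forall i, gram Lam i \in unitmx.

(** The mixed-product rule for Kronecker products: distributing the product of
    the sums over the directions gives the sum over all multi-indices. *)
Lemma sum_prod_dual (A B : 'I_n -> 'M[R]_N) f g :
  (forall i, A i *m B i = 1%:M) ->
  \sum_h (\prod_i A i (f i) ((h : {ffun 'I_n -> 'I_N}) i)) *
         (\prod_i B i (h i) (g i)) = (f == g)%:R.
Proof.
move=> AB; under eq_bigr do rewrite -big_split /=.
rewrite -(bigA_distr_bigA (fun i a => A i (f i) a * B i a (g i))) /=.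
under eq_bigr => i _.
  have -> : \sum_a A i (f i) a * B i a (g i) = (f i == g i)%:R.
    by have /matrixP/(_ (f i) (g i)) := AB i; rewrite !mxE.
  over.
have [->|/eqP nfg] := eqVneq f g; first by rewrite big1 // => i _; rewrite eqxx.
have [i nfgi] : exists i, f i != g i.
  apply: contrapT => /forallNP h; apply: nfg; apply/ffunP => i.
  by apply/eqP; have /negP := h i; rewrite negbK.
by rewrite (bigD1 i) //= (negbTE nfgi) mul0r.
Qed.

Section Family.
Variable Lam : 'I_n -> nat -> nat -> R.
Hypothesis uniLam : unisolvent Lam.

Let dual i := invmx (gram Lam i).

(** The polynomial with tensor data [y]: its coefficients are obtained by
    applying the tensor product of the inverse matrices. *)
Definition interp (y : ('I_n -> nat) -> R) : mpoly n R :=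
  \sum_(f : {ffun 'I_n -> 'I_N})
    (\sum_(h : {ffun 'I_n -> 'I_N})
       (\prod_i dual i (f i) (h i)) * y (fun i => h i))
    *: mpolyX R (mnm_ffun f).

Lemma boxed_interp y : boxed (interp y).
Proof.
move=> m; rewrite mcoeff_msupp linear_sum /= => nz i.
have [f /eqP <-] : exists f, mnm_ffun f == m.
  apply: contrapT => /forallNP h; move/eqP: nz; apply; apply: big1 => f _.
  by rewrite mcoeffZ mcoeffX; have /negP/negbTE -> := h f; rewrite mulr0.
by rewrite mnm_ffunE.
Qed.

Lemma interpP y alpha : (forall i, (alpha i < N)%N) ->
  tensor_form (fun i => Lam i (alpha i)) (interp y) = y alpha.
Proof.
move=> /ffun_of_small[g gE].
rewrite (_ : alpha = fun i => g i :> nat); last by apply/funext.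
rewrite linear_sum /=.
pose V f h := \prod_i gram Lam i (f i) ((h : {ffun 'I_n -> 'I_N}) i).
pose W f h := \prod_i dual i (f i) ((h : {ffun 'I_n -> 'I_N}) i).
transitivity (\sum_h (\sum_f V g f * W f h) * y (fun i => h i)).
  under [RHS]eq_bigr do rewrite mulr_suml.
  rewrite exchange_big /=; apply: eq_bigr => f _.
  rewrite linearZ /= tensor_formX mulr_suml; apply: eq_bigr => h _.
  have -> : \prod_i Lam i (g i) (mnm_ffun f i) = V g f.
    by apply: eq_bigr => i _; rewrite mxE mnm_ffunE.
  by rewrite /W; ring.
under eq_bigr => h _.
  rewrite (@sum_prod_dual (gram Lam) dual); last by move=> i; exact: mulmxV.
  over.
rewrite (bigD1 g) //= eqxx mul1r big1 ?addr0 // => h /negbTE.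
by rewrite eq_sym => ->; rewrite mul0r.
Qed.

Lemma boxed_tensor_form phi p : boxed p ->
  tensor_form phi p =
  \sum_(f : {ffun 'I_n -> 'I_N}) mcoeff (mnm_ffun f) p * \prod_i phi i (f i).
Proof.
move=> /boxedE {1}->; rewrite linear_sum; apply: eq_bigr => f _.
rewrite linearZ /= tensor_formX; congr (_ * _).
by apply: eq_bigr => i _; rewrite mnm_ffunE.
Qed.

(** Coefficients are recovered from tensor data, as the tensor product of the
    [dual i] is also a left inverse. *)
Lemma mcoeff_dual p f : boxed p ->
  mcoeff (mnm_ffun f) p =
  \sum_(h : {ffun 'I_n -> 'I_N}) (\prod_i dual i (f i) (h i)) *
    tensor_form (fun i => Lam i (h i)) p.
Proof.
move=> bp; under eq_bigr => h _ do rewrite boxed_tensor_form // mulr_sumr.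
rewrite exchange_big /=.
transitivity (\sum_g mcoeff (mnm_ffun g) p * (f == g)%:R).
  rewrite (bigD1 f) //= eqxx mulr1 big1 ?addr0 // => g /negbTE.
  by rewrite eq_sym => ->; rewrite mulr0.
apply: eq_bigr => g _.
rewrite -(@sum_prod_dual dual (gram Lam)) ?mulr_sumr; last first.
  by move=> i; exact: mulVmx.
apply: eq_bigr => h _; rewrite mulrCA; congr (_ * (_ * _)).
by apply: eq_bigr => i _; rewrite mxE.
Qed.

Lemma tensor_form_inj p q : boxed p -> boxed q ->
  (forall alpha, (forall i, (alpha i < N)%N) ->
     tensor_form (fun i => Lam i (alpha i)) p =
     tensor_form (fun i => Lam i (alpha i)) q) ->
  p = q.
Proof.
move=> bp bq pq; rewrite (boxedE bp) (boxedE bq); apply: eq_bigr => f _.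
congr (_ *: _); rewrite !mcoeff_dual //; apply: eq_bigr => h _.
by rewrite pq.
Qed.

End Family.

Definition coef_form (a k : nat) : R := (k == a)%:R.

(** Beyond degree [d i], the functionals of direction [i] read off the single
    coefficients that a polynomial of degree at most [d i] does not have. *)
Definition completed d Lam :=
  forall i a, (d i < a)%N -> Lam i a =1 coef_form a.

Lemma tensor_form_eq0 d phi i p :
  (forall k, (k <= d i)%N -> phi i k = 0) ->
  (forall m, m \in msupp p -> (m i <= d i)%N) -> tensor_form phi p = 0.
Proof.
move=> phi0 dp; rewrite /tensor_form big_seq big1 // => m /dp mi.
by rewrite (bigD1 i) //= phi0 // mul0r mulr0.
Qed.

(** Degree bounds are conditions on the tensor data: since the rows of the Gram
    matrices above the degree are unit vectors, so are those of the inverses,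
    and a coefficient of too large degree only involves data of too large
    index. *)
Lemma small_degree d Lam p : unisolvent Lam -> completed d Lam -> boxed p ->
  (forall alpha i, (forall j, (alpha j < N)%N) -> (d i < alpha i)%N ->
     tensor_form (fun j => Lam j (alpha j)) p = 0) ->
  forall m, m \in msupp p -> forall i, (m i <= d i)%N.
Proof.
move=> uL cL bp p0 m m_in i; rewrite leqNgt; apply/negP => di.
have [f fE] := ffun_of_small (bp m m_in).
have Em : m = mnm_ffun f by apply/mnmP => j; rewrite mnm_ffunE fE.
move: m_in; rewrite mcoeff_msupp Em (mcoeff_dual uL) // => /eqP; apply.
apply: big1 => h _; have [dh|hd] := ltnP (d i) (h i).
  by rewrite (p0 (fun j => h j) i) ?mulr0.
(* Row [f i] of the Gram matrix is a row of the identity, hence so is that row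
   of its inverse. *)
have rowE : invmx (gram Lam i) (f i) (h i) = (f i == h i)%:R.
  have /matrixP/(_ (f i) (h i)) := mulmxV (uL i); rewrite !mxE => <-.
  rewrite (bigD1 (f i)) //= mxE cL ?fE // /coef_form -fE eqxx mul1r.
  rewrite big1 ?addr0 // => l lf; rewrite mxE cL ?fE //.
  by rewrite /coef_form -fE (inj_eq val_inj) (negbTE lf) mul0r.
rewrite (bigD1 i) //= rowE (_ : f i == h i = false) ?mul0r //.
by apply/eqP => fh; move: hd; rewrite -fh leqNgt fE di.
Qed.
End Unisolvence.

(** * The one-variable functionals of the element *)

Section Families.
Context (R : realType).
Implicit Type (fam : nat -> nat -> R).

(** Values at the ends and mean, the data of a quadratic; then coefficients of
    higher powers. *)
Definition shear_family (a : nat) : nat -> R :=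
  match a with
  | 0 => eval_form R false
  | 1 => eval_form R true
  | 2 => int_form R
  | _ => coef_form R a
  end.

(** Mean and first moment, the data of an affine function; then coefficients of
    higher powers. *)
Definition mean_family (a : nat) : nat -> R :=
  if (a <= 1)%N then fun k => int_form R (k + a) else coef_form R a.

(** Values at the ends, then the coefficients which the divergence condition
    controls. *)
Definition normal_family (a : nat) : nat -> R :=
  match a with
  | 0 => eval_form R false
  | 1 => eval_form R true
  | _ => coef_form R a
  end.

(** A family is unisolvent when only the zero cubic, with coefficients
    [c], is annihilated by it. *)
Lemma family_unitmx fam :
  (forall c : nat -> R,
     (forall a, (a < 4)%N ->
        fam a 0%N * c 0%N + fam a 1%N * c 1%N +
        fam a 2%N * c 2%N + fam a 3%N * c 3%N = 0) ->
     [/\ c 0%N = 0, c 1%N = 0, c 2%N = 0 & c 3%N = 0]) ->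
  (\matrix_(a < 4, l < 4) fam a l) \in unitmx.
Proof.
move=> inj; set V := \matrix_(_, _) _.
rewrite -unitmx_tr -row_free_unit -kermx_eq0 -submx0.
apply/row_subP => i; set u := row i _.
have : u *m V^T = 0.
  by apply/sub_kermxP; apply: row_sub.
clearbody u => uV; suff -> : u = 0 by rewrite sub0mx.
pose c k := u 0 (inord k).
have cE (l : 'I_4) : u 0 l = c l by rewrite /c inord_val.
have [|c0 c1 c2 c3] := inj c.
  move=> a lta; have /matrixP/(_ 0 (Ordinal lta)) := uV.
  rewrite !mxE !big_ord_recr big_ord0 /= add0r !mxE !cE /= => E.
  by rewrite -[RHS]E; congr (_ + _ + _ + _); rewrite mulrC.
apply/rowP => l; rewrite mxE cE.
by case: l => [[|[|[|[|l]]]] ?].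
Qed.

Lemma shear_family_unitmx : (\matrix_(a < 4, l < 4) shear_family a l) \in unitmx.
Proof.
apply: family_unitmx => c h.
move: (h 0 isT) (h 1 isT) (h 2 isT) (h 3 isT).
rewrite /= /eval_form /int_form /coef_form !expr0n !expr1n /= => h0 h1 h2 h3.
by split; lra.
Qed.

Lemma mean_family_unitmx : (\matrix_(a < 4, l < 4) mean_family a l) \in unitmx.
Proof.
apply: family_unitmx => c h.
move: (h 0 isT) (h 1 isT) (h 2 isT) (h 3 isT).
rewrite /mean_family /= /int_form /coef_form !addn0 !addn1 /= => h0 h1 h2 h3.
by split; lra.
Qed.

Lemma normal_family_unitmx :
  (\matrix_(a < 4, l < 4) normal_family a l) \in unitmx.
Proof.
apply: family_unitmx => c h.
move: (h 0 isT) (h 1 isT) (h 2 isT) (h 3 isT).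
rewrite /= /eval_form /coef_form !expr0n !expr1n /= => h0 h1 h2 h3.
by split; lra.
Qed.

Lemma coef_form_unitmx : (\matrix_(a < 4, l < 4) coef_form R a l) \in unitmx.
Proof.
apply: family_unitmx => c h.
move: (h 0 isT) (h 1 isT) (h 2 isT) (h 3 isT).
by rewrite /coef_form /= => h0 h1 h2 h3; split; lra.
Qed.

(** The functionals applied in direction [l] to the component (i, j): for
    [i = j] the first alternative serves the direction [i] and the second one
    is void. *)
Definition comp_family (i j l : 'I_3) : nat -> nat -> R :=
  if (l == i) && (l == j) then normal_family
  else if (l == i) || (l == j) then shear_family else mean_family.

Definition comp_deg (i j l : 'I_3) : nat :=
  if (l == i) && (l == j) then 3 else if (l == i) || (l == j) then 2 else 1.

Lemma comp_family_unisolvent i j : unisolvent 4 (comp_family i j).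
Proof.
move=> l; rewrite /gram /comp_family; case: ifP => _.
  exact: normal_family_unitmx.
by case: ifP => _; [exact: shear_family_unitmx | exact: mean_family_unitmx].
Qed.

Lemma comp_family_completed i j : completed (comp_deg i j) (comp_family i j).
Proof.
move=> l a; rewrite /comp_deg /comp_family; case: ifP => _.
  by case: a => [|[|[|[|a]]]].
by case: ifP => _; case: a => [|[|[|a]]].
Qed.

(** The functionals applied in direction [l] to the [i]-th divergence; in
    direction [i] they read off coefficients, since it is the coefficients of
    positive degree that have to vanish. *)
Definition div_family (i l : 'I_3) : nat -> nat -> R :=
  if l == i then coef_form R else mean_family.

Definition div_deg (i l : 'I_3) : nat := (l != i).

Lemma div_family_unisolvent i : unisolvent 4 (div_family i).
Proof.
move=> l; rewrite /gram /div_family; case: ifP => _.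
  exact: coef_form_unitmx.
exact: mean_family_unitmx.
Qed.

Lemma div_family_completed i : completed (div_deg i) (div_family i).
Proof.
by move=> l a; rewrite /div_deg /div_family; case: eqP => _ //; case: a => [|[|a]].
Qed.

(** Differentiation is transposed to the functional, the derivative of x^k
    being k x^(k-1). *)
Lemma tensor_form_deriv n (phi : 'I_n -> nat -> R) i (p : mpoly n R) :
  tensor_form phi (mderiv i p) =
  tensor_form (fun l k => if l == i then k%:R * phi l k.-1 else phi l k) p.
Proof.
rewrite {1}(mpolyE p) (linear_sum (mderiv i)) /= (linear_sum (tensor_form phi)) /=.
apply: eq_bigr => m _.
rewrite mderivZ !linearZ /= mderivX linearZ /= tensor_formX; congr (_ * _).
rewrite (bigD1 i) // [RHS](bigD1 i) //= eqxx mulrA; congr (_ * _ * _).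
  by rewrite mnmBE mnm1E eqxx subn1.
by apply: eq_bigr => l /negbTE li; rewrite mnmBE mnm1E eq_sym li subn0.
Qed.

End Families.

(** * Degree bounds and the space Sigma *)

Section Degrees.
Context (R : realType).
Implicit Types (p : mpoly 3 R) (d : 'I_3 -> nat).

Lemma deg_leP d p :
  deg_le d p <-> forall (m : multinom 3) i, (d i < m i)%N -> mcoeff m p = 0.
Proof.
split=> [dp m i dm|p0 m m_in i].
  apply: memN_msupp_eq0; apply/negP => /dp/(_ i).
  by rewrite leqNgt dm.
rewrite leqNgt; apply/negP => /p0 m0.
by move: m_in; rewrite mcoeff_msupp m0 eqxx.
Qed.

Lemma deg_leW d d' p : (forall i, d i <= d' i)%N -> deg_le d p -> deg_le d' p.
Proof. by move=> dd' dp m /dp h i; exact: leq_trans (h i) (dd' i). Qed.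

Lemma deg_le_sum d (F : 'I_3 -> mpoly 3 R) :
  (forall j, deg_le d (F j)) -> deg_le d (\sum_j F j).
Proof.
move=> dF; apply/deg_leP => m i dm; rewrite linear_sum big1 // => j _.
by have /deg_leP := dF j; apply; exact: dm.
Qed.

Lemma deg_le_deriv d i p :
  deg_le d p -> deg_le (fun l => d l - (l == i))%N (mderiv i p).
Proof.
move=> /deg_leP dp; apply/deg_leP => m l dm.
rewrite mcoeff_deriv (dp _ l) ?mul0rn // mnmDE mnm1E eq_sym.
by move: dm; case: (l == i) => /=; lia.
Qed.

Lemma ord3P (P : 'I_3 -> Prop) : P 0 -> P 1 -> P 2 -> forall i, P i.
Proof.
move=> P0 P1 P2 [[|[|[|i]]] hi] //.
- by rewrite (_ : Ordinal hi = 0) //; apply: val_inj.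
- by rewrite (_ : Ordinal hi = 1) //; apply: val_inj.
- by rewrite (_ : Ordinal hi = 2) //; apply: val_inj.
Qed.

(** The conditions defining the space, uniformly in the indices. *)
Lemma SigmaP (tau : 'M[mpoly 3 R]_3) :
  Sigma tau <->
  [/\ tau^T = tau,
      forall i j : 'I_3, (i <= j)%N -> deg_le (comp_deg i j) (tau i j) &
      forall i, deg_le (div_deg i) (divergence tau i)].
Proof.
split=> [[sym ? ? ? ? ? ? ? ? ?]|[sym deg div]].
  split=> //.
    elim/ord3P; elim/ord3P => // _; apply: deg_leW; try eassumption;
      by elim/ord3P.
  by elim/ord3P; apply: deg_leW; try eassumption; elim/ord3P.
by split; rewrite // /Pspace;
  first [apply: deg_leW; last exact: deg | apply: deg_leW; last exact: div];
  elim/ord3P.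
Qed.

End Degrees.

(** * Degrees of freedom as tensor data *)

Definition on_pair (i j l : 'I_3) : bool := (l == i) || (l == j).

Lemma third_index (i j : 'I_3) : i != j ->
  exists k, [/\ k != i, k != j & forall l, l != k -> on_pair i j l].
Proof.
move: i j; elim/ord3P; elim/ord3P => //= _;
  [exists 2|exists 1|exists 2|exists 0|exists 1|exists 0];
  split=> //; by elim/ord3P.
Qed.

Definition dof_row (s : dof) : 'I_3 :=
  match s with
  | EdgeDof i _ _ _ | NormalDof i _ | ShearDof i _ _ _ | CellDof i _ => i
  end.

Definition dof_col (s : dof) : 'I_3 :=
  match s with
  | NormalDof j _ | EdgeDof _ j _ _ | ShearDof _ j _ _ | CellDof _ j => j
  end.

Lemma admissible_le s : admissible s -> (dof_row s <= dof_col s)%N.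
Proof.
by case: s => [i j a b|i a|i j l a|i j] //= => [/ltnW|/andP[/ltnW]|/ltnW].
Qed.

(** The exponents of the test functions of [s]: degree at most 1 in the
    directions off the pair (row, column) of the component, 0 in the others.
    This covers the normal dofs too, whose row and column coincide. *)
Definition frozen (s : dof) (m : 'I_3 -> nat) : Prop :=
  forall l, (m l <= ~~ on_pair (dof_row s) (dof_col s) l)%N.

Lemma not_both (i j l : 'I_3) : i != j -> (l == i) && (l == j) = false.
Proof. by move=> ij; apply/negbTE; apply: contraNN ij => /andP[/eqP <-]. Qed.

Section Dofs.
Context (R : realType).
Implicit Types (p v : mpoly 3 R) (s : dof) (sigma : 'M[mpoly 3 R]_3).

Lemma frozen_test_space s v : admissible s -> test_space s v ->
  forall m, m \in msupp v -> frozen s m.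
Proof.
have span i j : span_1x i j v -> forall m, m \in msupp v ->
    forall l, (m l <= ~~ on_pair i j l)%N.
  move=> [k [c [d [ki kj ->]]]] m.
  rewrite mcoeff_msupp mcoeffD mcoeffC mcoeffZ mcoeffX => nz l.
  have [->|m0] := eqVneq m mnm0; first by rewrite mnm0E.
  move: nz; rewrite (negbTE m0) mulr0 add0r.
  case: (eqVneq (mnm1 k) m) => [<- _|_]; last by rewrite mulr0 eqxx.
  rewrite mnm1E /on_pair; case: eqP => // <-.
  by rewrite (negbTE ki) (negbTE kj).
case: s => [i j a b|i a|i j l a|i j] /= _; try exact: span.
move=> dv m /dv h l; have := h l; rewrite /= /on_pair orbb.
by case: (l == i).
Qed.

Lemma test_space_mon s (m : multinom 3) : admissible s -> frozen s m ->
  test_space s (mpolyX R m).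
Proof.
have span (i j : 'I_3) : (i < j)%N -> (forall l, (m l <= ~~ on_pair i j l)%N) ->
    span_1x i j (mpolyX R m).
  move=> ij frz; have [|k [ki kj kP]] := @third_index i j.
    by rewrite -val_eqE /=; lia.
  have m0 l : l != k -> m l = 0%N.
    by move=> /kP h; have := frz l; rewrite h; case: (m l).
  have := frz k; rewrite /on_pair (negbTE ki) (negbTE kj) /=.
  case mk : (m k) => [|[|//]] _.
    exists k, 1, 0; split=> //; rewrite scale0r addr0.
    rewrite (_ : m = mnm0) ?mpolyX0 //.
    by apply/mnmP => l; rewrite mnm0E; have [->|/m0] := eqVneq l k.
  exists k, 0, 1; split=> //; rewrite mpolyC0 add0r scale1r; congr mpolyX.
  apply/mnmP => l; rewrite mnm1E; have [->|/[dup] lk /m0 ->] := eqVneq l k.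
    by rewrite mk ?eqxx.
  by rewrite 1?eq_sym ?(negbTE lk).
case: s => [i j a b|i a|i j l a|i j] /=.
- exact: span.
- move=> _ frz m'; rewrite msuppX inE => /eqP -> l.
  by have := frz l; rewrite /= /on_pair orbb; case: (l == i).
- by move=> /andP[ij _]; exact: span.
- exact: span.
Qed.

Definition dof_form s (l : 'I_3) : nat -> R :=
  match s with
  | EdgeDof i j a b =>
      if l == i then eval_form R a else if l == j then eval_form R b
      else int_form R
  | NormalDof i a => if l == i then eval_form R a else int_form R
  | ShearDof _ _ i a => if l == i then eval_form R a else int_form R
  | CellDof _ _ => int_form R
  end.

Lemma momentE s sigma v : admissible s ->
  moment s sigma v =
  tensor_form (dof_form s) (sigma (dof_row s) (dof_col s) * v).
Proof.
have mevE p q : (fun x : 'I_3 -> R => meval x p * meval x q) =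
    fun x => meval x (p * q) by apply/funext => x; rewrite mevalM.
case: s => [i j a b|i a|i j l a|i j] /= h; rewrite mevE.
- by rewrite edge_integral_meval // -val_eqE /=; move: h; lia.
- exact: face_integral_meval.
- exact: face_integral_meval.
- exact: cube_integral_meval.
Qed.

(** The multi-index of the tensor datum that the dof [s] measures against the
    monomial of exponents [m]: 0 or 1 for evaluation at that end, 2 for the
    mean along a direction of the pair, and [m l] for the moment of that order
    in the remaining directions. *)
Definition dof_index s (m : 'I_3 -> nat) (l : 'I_3) : nat :=
  match s with
  | EdgeDof i j a b => if l == i then a : nat else if l == j then b : nat else m l
  | NormalDof i a => if l == i then a : nat else m l
  | ShearDof i j k a =>
      if l == k then a : nat else if on_pair i j l then 2 else m l
  | CellDof i j => if on_pair i j l then 2 else m l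
  end.

(** A test monomial has exponent 0 in the directions of the pair, so it leaves
    the evaluations and means there unchanged, and exponent 0 or 1 in the
    others, where it turns the mean into [mean_family (m l)]. *)
Lemma moment_mon s sigma (m : multinom 3) : admissible s -> frozen s m ->
  moment s sigma (mpolyX R m) =
  tensor_form (fun l => comp_family R (dof_row s) (dof_col s) l (dof_index s m l))
    (sigma (dof_row s) (dof_col s)).
Proof.
move=> adm frz; rewrite momentE // tensor_formMX.
apply: eq_tensor_form => l k; have := frz l.
have mean1 e : (m l <= 1)%N -> int_form R (e + m l) = mean_family R (m l) e.
  by rewrite /mean_family => ->.
case: s adm {frz} => [i j a b|i a|i j h a|i j]; rewrite /= /comp_family /on_pair => adm.
- have ij : i != j by rewrite -val_eqE /=; move: adm; lia.
  have [->|li] := eqVneq l i.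
    rewrite (negbTE ij) /= => m0; rewrite (_ : m i = 0)%N ?addn0; last by lia.
    by case: a.
  have [->|lj] := eqVneq l j; last by move=> /mean1.
  by move=> m0; rewrite (_ : m j = 0)%N ?addn0; [case: b|lia].
- have [->|li] := eqVneq l i; last by move=> /mean1.
  by move=> m0; rewrite (_ : m i = 0)%N ?addn0; [case: a|lia].
- move: adm => /andP[ij]; rewrite !inE.
  have {}ij : i != j by rewrite -val_eqE /=; move: ij; lia.
  rewrite not_both //.
  move=> hij; have [->|lh] := eqVneq l h.
    by rewrite hij => m0; rewrite (_ : m h = 0)%N ?addn0; [case: a|lia].
  case: ((l == i) || (l == j)); last by move=> /mean1.
  by move=> m0; rewrite (_ : m l = 0)%N ?addn0 //; lia.
- have ij : i != j by rewrite -val_eqE /=; move: adm; lia.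
  rewrite not_both //.
  case: ((l == i) || (l == j)); last by move=> /mean1.
  by move=> m0; rewrite (_ : m l = 0)%N ?addn0 //; lia.
Qed.

(** The multi-indices that dofs measure.  On a diagonal component, the indices 2
    and 3 of direction [i] stand for coefficients, which no dof measures. *)
Definition dof_bound (i j l : 'I_3) : nat :=
  if on_pair i j l && (i != j) then 2 else 1.

(** [dof_at] and [freeze] invert [dof_index]: they recover the dof and the test
    monomial from the multi-index. *)
Definition dof_at (i j : 'I_3) (alpha : 'I_3 -> nat) : dof :=
  if i == j then NormalDof i (alpha i == 1)%N
  else if (alpha i < 2)%N then
    if (alpha j < 2)%N then EdgeDof i j (alpha i == 1)%N (alpha j == 1)%N
    else ShearDof i j i (alpha i == 1)%N
  else if (alpha j < 2)%N then ShearDof i j j (alpha j == 1)%N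
  else CellDof i j.

Definition freeze (i j : 'I_3) (alpha : 'I_3 -> nat) : multinom 3 :=
  Multinom [tuple (if on_pair i j l then 0 else alpha l)%N | l < 3].

Lemma dof_at_row i j alpha : dof_row (dof_at i j alpha) = i.
Proof. by rewrite /dof_at; do !case: ifP. Qed.

Lemma dof_at_col i j alpha : dof_col (dof_at i j alpha) = j.
Proof. by rewrite /dof_at; case: eqP => [->|_]; do ?case: ifP. Qed.

Lemma dof_at_admissible (i j : 'I_3) alpha :
  (i <= j)%N -> admissible (dof_at i j alpha).
Proof.
move=> ij; rewrite /dof_at; case: eqP => // /eqP; rewrite -val_eqE /= => nij.
have {}ij : (i < j)%N by lia.
by do !case: ifP; rewrite //= ij ?inE ?eqxx ?orbT.
Qed.

Lemma freeze_frozen i j alpha : (forall l, (alpha l <= dof_bound i j l)%N) ->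
  frozen (dof_at i j alpha) (freeze i j alpha).
Proof.
move=> b l; rewrite dof_at_row dof_at_col mnmE; have := b l; rewrite /dof_bound.
by case: on_pair.
Qed.

Lemma dof_atK i j alpha l : (forall l, (alpha l <= dof_bound i j l)%N) ->
  dof_index (dof_at i j alpha) (freeze i j alpha) l = alpha l.
Proof.
move=> b; have := b l; have := b i; have := b j.
rewrite /dof_bound /dof_at; case: (eqVneq i j) => [<-|ij] /=.
  rewrite /freeze mnmE /on_pair orbb andbF.
  by have [->|] := eqVneq l i => //; case: (alpha i) => [|[|]].
rewrite /on_pair !eqxx orbT /= => bj bi bl.
do 2!case: ltnP => ?; rewrite /= ?mnmE /on_pair;
  have [->|li] := eqVneq l i; rewrite ?(negbTE ij) ?eqxx ?orbT /=;
  try (have [->|lj] := eqVneq l j; rewrite ?eqxx /=); by [|lia].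
Qed.

Lemma dof_indexK s (m : multinom 3) : admissible s -> frozen s m ->
  let alpha := dof_index s m in
  [/\ dof_at (dof_row s) (dof_col s) alpha = s,
      freeze (dof_row s) (dof_col s) alpha = m &
      forall l, (alpha l <= dof_bound (dof_row s) (dof_col s) l)%N].
Proof.
have nat_boolK (a : bool) : ((a : nat) == 1)%N = a by case: a.
have bool_lt2 (a : bool) : (a < 2)%N by case: a.
have neq (i j : 'I_3) : (i < j)%N -> i != j by rewrite -val_eqE /=; lia.
move=> adm frz alpha; split.
- rewrite /alpha; case: s adm {frz alpha} => [i j a b|i a|i j h a|i j];
    rewrite /dof_at /dof_index /= ?eqxx ?nat_boolK // => adm.
  + have ij := neq _ _ adm; have ji : j != i by rewrite eq_sym.
    by rewrite (negbTE ij) ?eqxx (negbTE ji) !bool_lt2 !nat_boolK.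
  + move: adm => /andP[/neq ij]; have ji : j != i by rewrite eq_sym.
    rewrite !inE (negbTE ij) /on_pair !eqxx orbT /=.
    by case/orP => /eqP ->; rewrite !eqxx ?(negbTE ij) ?(negbTE ji) /=
      !bool_lt2 !nat_boolK.
  + by rewrite (negbTE (neq _ _ adm)) /on_pair !eqxx orbT.
- apply/mnmP => l; rewrite mnmE; have := frz l.
  have [_|nP _] := boolP (on_pair _ _ l); first by case: (m l).
  rewrite /alpha; case: s nP adm {frz alpha} => [i j a b|i a|i j h a|i j] /=;
    rewrite /on_pair negb_or /=.
  + by move=> /andP[/negbTE -> /negbTE ->].
  + by rewrite andbb => /negbTE ->.
  + move=> /andP[li lj] /andP[_]; rewrite !inE (negbTE li) (negbTE lj).
    by case/orP => /eqP ->; rewrite ?(negbTE li) ?(negbTE lj).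
  + by move=> /andP[/negbTE -> /negbTE ->].
- move=> l; have := frz l; rewrite /alpha /dof_bound.
  case: s adm {frz alpha} => [i j a b|i a|i j h a|i j] /=; rewrite /on_pair.
  + move=> /neq ->; rewrite andbT; case: (l == i) => /=; first by case: a.
    by case: (l == j) => //= _; case: b.
  + by move=> _; rewrite eqxx andbF orbb; case: (l == i) => //= _; case: a.
  + move=> /andP[/neq -> _]; rewrite andbT; case: (l == h).
      by move=> _; case: (_ || _); case: a.
    by case: (_ || _).
  + by move=> /neq ->; case: (_ || _).
Qed.

End Dofs.

(** * The divergence condition *)

Section Main.
Context (R : realType).
Implicit Types (sigma : 'M[mpoly 3 R]_3) (i j l : 'I_3) (alpha : 'I_3 -> nat).

Definition comp_form i j alpha : mpoly 3 R -> R :=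
  tensor_form (fun l => comp_family R i j l (alpha l)).

Lemma dof_bound_le i j alpha : i != j ->
  (forall l, (alpha l <= comp_deg i j l)%N) ->
  forall l, (alpha l <= dof_bound i j l)%N.
Proof.
move=> ij h l; have := h l; rewrite /comp_deg /dof_bound /on_pair ij andbT.
by rewrite not_both.
Qed.

Lemma boxed_deg_le (d : 'I_3 -> nat) (p : mpoly 3 R) :
  (forall l, (d l < 4)%N) -> deg_le d p -> boxed 4 p.
Proof. by move=> d4 dp m /dp h l; exact: leq_ltn_trans (h l) (d4 l). Qed.

Lemma comp_deg_lt4 i j l : (comp_deg i j l < 4)%N.
Proof. by rewrite /comp_deg; case: ifP => // _; case: ifP. Qed.

Lemma completed_eq0 d d' (Lam : 'I_3 -> nat -> nat -> R) alpha l (p : mpoly 3 R) :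
  completed d' Lam -> deg_le d p -> (d l < alpha l)%N -> (d' l < alpha l)%N ->
  tensor_form (fun l => Lam l (alpha l)) p = 0.
Proof.
move=> cL dp dl dl'; apply: (@tensor_form_eq0 _ _ d _ l); last by move=> m /dp; exact.
move=> k kd; rewrite cL // /coef_form; case: eqP => // E.
by move: kd; rewrite E leqNgt dl.
Qed.

(** Differentiation along [i] lowers the order of the coefficient to read off. *)
Definition lower i alpha l : nat := if l == i then (alpha l).-1 else alpha l.

Definition div_form i alpha : mpoly 3 R -> R :=
  tensor_form (fun l => div_family R i l (lower i alpha l)).

(** The contribution of the off-diagonal components to the data of the [i]-th
    divergence. *)
Definition shear_div sigma i alpha : R :=
  \sum_(j | j != i) div_form i alpha (mderiv j (sigma i j)).

(** The coefficient of x_i^(a-1) in the derivative of [sigma i i] is [a] times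
    that of x_i^a in [sigma i i], hence the factor [a = alpha i]; the bound
    [2 <= a] makes [comp_family] read off that coefficient. *)
Lemma div_form_divergence sigma i alpha : (2 <= alpha i)%N ->
  div_form i alpha (divergence sigma i) =
  (alpha i)%:R * comp_form i i alpha (sigma i i) + shear_div sigma i alpha.
Proof.
move=> ai; rewrite /divergence /div_form linear_sum /= (bigD1 i) //=; congr (_ + _).
rewrite tensor_form_deriv -[RHS]/(_ *: comp_form i i alpha (sigma i i)).
rewrite /comp_form /tensor_form scaler_sumr; apply: eq_bigr => m _.
rewrite /GRing.scale /= mulrCA; congr (_ * _).
rewrite (bigD1 i) // [in RHS](bigD1 i) //= mulrA eqxx; congr (_ * _).
  rewrite /div_family /lower /comp_family !eqxx /=.
  case: (alpha i) ai => [|[|a]] //= _; rewrite /coef_form.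
  case: (m i) => [|k] /=; first by rewrite mul0r mulr0.
  by rewrite eqSS; case: eqP => [->|]; rewrite ?mulr0 ?mulr1.
apply: eq_bigr => l /negbTE li.
by rewrite /div_family /lower /comp_family li.
Qed.

(** As the data of positive order of the divergence vanish, the off-diagonal
    components determine the data of [sigma i i] that no dof measures. *)
Lemma comp_form_diag sigma i alpha :
  deg_le (div_deg i) (divergence sigma i) -> (2 <= alpha i)%N ->
  comp_form i i alpha (sigma i i) = - (alpha i)%:R^-1 * shear_div sigma i alpha.
Proof.
move=> dd ai; have := div_form_divergence sigma ai.
have div0 : (div_deg i i < lower i alpha i)%N.
  by rewrite /div_deg /lower eqxx; case: (alpha i) ai => [|[]].
rewrite /div_form (completed_eq0 (@div_family_completed R i) dd div0 div0).
have a0 : (alpha i)%:R != 0 :> R by rewrite pnatr_eq0; case: (alpha i) ai.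
move=> /esym/eqP; rewrite addr_eq0 => /eqP E.
by apply: (mulfI a0); rewrite E mulNr mulrN mulrA divff // mul1r.
Qed.

(** * Uniqueness *)

Definition same_moments sigma1 sigma2 : Prop :=
  forall (s : dof) (v : mpoly 3 R), admissible s -> test_space s v ->
    moment s sigma1 v = moment s sigma2 v.

Lemma comp_form_moment sigma i j alpha : (i <= j)%N ->
  (forall l, (alpha l <= dof_bound i j l)%N) ->
  comp_form i j alpha (sigma i j) =
  moment (dof_at i j alpha) sigma (mpolyX R (freeze i j alpha)).
Proof.
move=> ij b; rewrite moment_mon ?dof_at_admissible //; last exact: freeze_frozen.
rewrite dof_at_row dof_at_col; apply: eq_tensor_form => l.
by rewrite dof_atK.
Qed.

(** Each tensor datum of a component is either a moment, or zero because of the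
    degree bounds, or, on the diagonal, a function of the off-diagonal
    components, which are already known to agree. *)
Lemma Sigma_unique sigma1 sigma2 : Sigma sigma1 -> Sigma sigma2 ->
  same_moments sigma1 sigma2 -> sigma1 = sigma2.
Proof.
move=> /SigmaP[sym1 deg1 div1] /SigmaP[sym2 deg2 div2] same.
have symE sigma i j : sigma^T = sigma -> sigma i j = sigma j i.
  by move=> {1}<-; rewrite mxE.
have bounded (i j : 'I_3) alpha : (i <= j)%N ->
    (forall l, (alpha l <= dof_bound i j l)%N) ->
    comp_form i j alpha (sigma1 i j) = comp_form i j alpha (sigma2 i j).
  move=> ij b; rewrite !comp_form_moment //; apply: same.
    exact: dof_at_admissible.
  by apply: test_space_mon; [exact: dof_at_admissible | exact: freeze_frozen].
have high (i j l : 'I_3) alpha : (i <= j)%N -> (comp_deg i j l < alpha l)%N ->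
    comp_form i j alpha (sigma1 i j) = comp_form i j alpha (sigma2 i j).
  move=> ij hl; rewrite /comp_form.
  by rewrite !(completed_eq0 (@comp_family_completed R i j) _ hl hl);
    [|exact: deg2|exact: deg1].
have inj (i j : 'I_3) : (i <= j)%N ->
   (forall alpha, (forall l, (alpha l <= comp_deg i j l)%N) ->
    comp_form i j alpha (sigma1 i j) = comp_form i j alpha (sigma2 i j)) ->
   sigma1 i j = sigma2 i j.
  move=> ij E; apply: (tensor_form_inj (@comp_family_unisolvent R i j)).
  - exact: boxed_deg_le (comp_deg_lt4 i j) (deg1 _ _ ij).
  - exact: boxed_deg_le (comp_deg_lt4 i j) (deg2 _ _ ij).
  move=> alpha _; have [/forallP/= b|] := boolP [forall l, alpha l <= comp_deg i j l]%N.
    exact: E.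
  by rewrite negb_forall => /existsP[l]; rewrite -ltnNge; exact: high.
have lt_eq (i j : 'I_3) : (i < j)%N -> sigma1 i j = sigma2 i j.
  move=> ij; apply: (inj _ _ (ltnW ij)) => alpha b; apply: bounded (ltnW ij) _.
  by apply: dof_bound_le b; rewrite -val_eqE /=; lia.
have neq_eq i j : i != j -> sigma1 i j = sigma2 i j.
  rewrite -val_eqE /= neq_ltn => /orP[/lt_eq //|ji].
  by rewrite (symE sigma1) // (symE sigma2) //; exact: lt_eq.
apply/matrixP => i j; have [<-|/neq_eq //] := eqVneq i j.
apply: (inj _ _ (leqnn i)) => alpha b; have [ai|ai] := ltnP (alpha i) 2.
  apply: bounded => // l; have := b l.
  rewrite /comp_deg /dof_bound eqxx andbF.
  by have [->|li] := eqVneq l i; [lia|].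
rewrite !comp_form_diag //; congr (_ * _).
by apply: eq_bigr => k ki; rewrite neq_eq // eq_sym.
Qed.

(** * Existence *)

Section Existence.
Variable L : dof -> {scalar (mpoly 3 R)}.

Definition prescribed i j alpha : R :=
  if [forall l, alpha l <= dof_bound i j l]%N
  then L (dof_at i j alpha) (mpolyX R (freeze i j alpha)) else 0.

(** Only dofs with row at most column are admissible, so the lower triangle is
    filled by symmetry. *)
Definition shear_part i j : mpoly 3 R :=
  if (i <= j)%N then interp 4 (comp_family R i j) (prescribed i j)
  else interp 4 (comp_family R j i) (prescribed j i).

Definition shear_field : 'M[mpoly 3 R]_3 := \matrix_(i, j) shear_part i j.

(** The face moments are prescribed; the coefficients of x_i^2 and x_i^3 are
    those that make the [i]-th divergence constant in x_i, see
    [comp_form_diag]. *)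
Definition diag_data i alpha : R :=
  if (alpha i < 2)%N then prescribed i i alpha
  else - (alpha i)%:R^-1 * shear_div shear_field i alpha.

Definition stress_field : 'M[mpoly 3 R]_3 :=
  \matrix_(i, j) if i == j then interp 4 (comp_family R i i) (diag_data i)
                 else shear_part i j.

Let sym_shear i j : shear_part i j = shear_part j i.
Proof.
rewrite /shear_part; case: (ltngtP i j) => // ij.
by have -> : i = j by apply: val_inj.
Qed.

Let stress_form i j alpha : (i <= j)%N -> (forall l, (alpha l < 4)%N) ->
  comp_form i j alpha (stress_field i j) =
  if i == j then diag_data i alpha else prescribed i j alpha.
Proof.
move=> ij a4; rewrite mxE /comp_form; case: eqP => [<-|_].
  exact: interpP (@comp_family_unisolvent R i i) _ _ a4.
rewrite /shear_part ij.
exact: interpP (@comp_family_unisolvent R i j) _ _ a4.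
Qed.

Let prescribed_eq0 i j alpha l : (dof_bound i j l < alpha l)%N ->
  prescribed i j alpha = 0.
Proof.
by move=> h; rewrite /prescribed; case: forallP => // /(_ l); rewrite leqNgt h.
Qed.

Let shear_deg i j : i != j -> deg_le (comp_deg i j) (stress_field i j).
Proof.
have lt (i' j' : 'I_3) : (i' < j')%N ->
    deg_le (comp_deg i' j') (shear_part i' j').
  move=> ij; rewrite /shear_part (ltnW ij).
  apply: (small_degree (@comp_family_unisolvent R i' j')
    (@comp_family_completed R i' j')).
    exact: boxed_interp.
  move=> alpha l a4 hl.
  rewrite (interpP (@comp_family_unisolvent R i' j')) //.
  rewrite (@prescribed_eq0 _ _ _ l) //.
  apply: leq_ltn_trans hl; rewrite /dof_bound /comp_deg /on_pair.
  have ij' : i' != j' by rewrite -val_eqE /=; lia.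
  by rewrite ij' andbT; case: (l == i'); case: (l == j').
move=> ij; rewrite mxE (negbTE ij).
move: ij; rewrite -val_eqE /= neq_ltn => /orP[/lt //|/lt ji].
rewrite sym_shear; apply: deg_leW ji => l.
by rewrite /comp_deg andbC orbC.
Qed.

Let shear_div_deg i j : j != i ->
  deg_le (fun l => if l == i then 2 else 1)%N (mderiv j (stress_field i j)).
Proof.
move=> ji; have ij : i != j by rewrite eq_sym.
apply: deg_leW (deg_le_deriv (i := j) (shear_deg ij)) => l; rewrite /comp_deg.
by have [->|li] := eqVneq l i; [rewrite (negbTE ij)|case: (l == j)].
Qed.

Let shear_div_field i alpha :
  shear_div stress_field i alpha = shear_div shear_field i alpha.
Proof. by apply: eq_bigr => j ji; rewrite !mxE eq_sym (negbTE ji). Qed.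

(** The data required by the divergence condition respect the degree bound in
    the directions other than [i] because the off-diagonal derivatives do. *)
Let diag_deg i : deg_le (comp_deg i i) (stress_field i i).
Proof.
rewrite mxE eqxx.
apply: (small_degree (@comp_family_unisolvent R i i) (@comp_family_completed R i i)).
  exact: boxed_interp.
move=> alpha l a4 hl; rewrite (interpP (@comp_family_unisolvent R i i)) //.
have li : l != i.
  by apply: contraTneq hl => ->; rewrite /comp_deg eqxx -leqNgt -ltnS.
have al : (1 < alpha l)%N by move: hl; rewrite /comp_deg (negbTE li).
rewrite /diag_data; case: ifP => _.
  by rewrite (@prescribed_eq0 _ _ _ l) // /dof_bound eqxx andbF.
rewrite -shear_div_field /shear_div big1 ?mulr0 // => j ji.
apply: (completed_eq0 (l := l) (@div_family_completed R i) (shear_div_deg ji)).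
  by rewrite /lower (negbTE li).
by rewrite /lower /div_deg (negbTE li).
Qed.

(** The divergence has degree at most 2 in direction [i]; its data of order 1
    and 2 in that direction vanish by the choice of [diag_data]. *)
Let stress_div_deg i : deg_le (div_deg i) (divergence stress_field i).
Proof.
have dd : deg_le (fun l => if l == i then 2 else 1)%N (divergence stress_field i).
  apply: deg_le_sum => j; have [->|ji] := eqVneq j i; last exact: shear_div_deg.
  apply: deg_leW (deg_le_deriv (i := i) (diag_deg (i := i))) => l.
  by rewrite /comp_deg; case: (l == i).
apply: (small_degree (@div_family_unisolvent R i) (@div_family_completed R i)).
  by apply: boxed_deg_le dd => l; case: ifP.
move=> beta l b4 hl.
(* Data of index above the crude degree bound [dd] vanish. *)
have [high|low] := ltnP (if l == i then 2 else 1)%N (beta l).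
  exact: (completed_eq0 (l := l) (@div_family_completed R i) dd).
have li : l = i.
  by apply/eqP; move: hl low; rewrite /div_deg; case: eqP => //= _; lia.
move: hl low; rewrite {}li /div_deg !eqxx /= => b0 b2 {l}.
(* [beta = lower i alpha], the situation of [div_form_divergence]. *)
pose alpha l := if l == i then (beta l).+1 else beta l.
have lowerE : (fun l => div_family R i l (beta l)) =
    fun l => div_family R i l (lower i alpha l).
  by apply/funext => l; rewrite /lower /alpha; case: eqP.
have ai : (2 <= alpha i)%N by rewrite /alpha eqxx.
have a4 l : (alpha l < 4)%N.
  by rewrite /alpha; case: eqP => [->|_]; [rewrite ltnS|exact: b4].
rewrite lowerE -/(div_form i alpha _) div_form_divergence // stress_form // eqxx.
rewrite /diag_data ltnNge ai /= shear_div_field mulNr mulrN mulrA divff.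
  by rewrite mul1r addNr.
by rewrite pnatr_eq0; case: (alpha i) ai.
Qed.

Lemma Sigma_stress_field : Sigma stress_field.
Proof.
apply/SigmaP; split=> [|i j _|i]; last exact: stress_div_deg.
  by apply/matrixP => i j; rewrite !mxE sym_shear eq_sym; case: eqP => // ->.
by have [->|/shear_deg //] := eqVneq i j; exact: diag_deg.
Qed.

(** Both sides are linear in the test function, so it suffices to test on
    monomials, where the moment is a tensor datum, prescribed to be the value
    of [L]. *)
Lemma moment_stress_field (s : dof) (v : mpoly 3 R) : admissible s ->
  test_space s v -> moment s stress_field v = L s v.
Proof.
move=> adm tv; rewrite momentE // (mpolyE v) mulr_sumr !linear_sum.
rewrite big_seq [RHS]big_seq; apply: eq_bigr => m m_in.
have frz := frozen_test_space adm tv m_in.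
rewrite -scalerAr !linearZ /= -momentE // moment_mon //; congr (_ * _).
have [sE mE b] := dof_indexK adm frz.
have ij := admissible_le adm.
move: (dof_row s) (dof_col s) sE mE b ij => i j sE mE b ij.
have pE : prescribed i j (dof_index s m) = L s (mpolyX R m).
  by rewrite /prescribed sE mE; case: forallP.
rewrite -[LHS]/(comp_form i j (dof_index s m) (stress_field i j)).
rewrite stress_form //; last first.
  by move=> l; apply: leq_ltn_trans (b l) _; rewrite /dof_bound; case: ifP.
case: eqP => // ijE; rewrite /diag_data ifT; first by rewrite -pE -ijE.
by apply: leq_ltn_trans (b i) _; rewrite /dof_bound ijE eqxx andbF.
Qed.
End Existence.
End Main.

Theorem lemma2p1 (R : realType) :
  (forall sigma1 sigma2 : 'M[mpoly 3 R]_3,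
     Sigma sigma1 -> Sigma sigma2 ->
     (forall (s : dof) (v : mpoly 3 R), admissible s -> test_space s v ->
        moment s sigma1 v = moment s sigma2 v) ->
     sigma1 = sigma2) /\
  (forall L : dof -> {scalar (mpoly 3 R)},
     exists sigma : 'M[mpoly 3 R]_3, Sigma sigma /\
       forall (s : dof) (v : mpoly 3 R), admissible s -> test_space s v ->
         moment s sigma v = L s v).
Proof.
split=> [sigma1 sigma2|L]; first exact: Sigma_unique.
exists (stress_field L); split; first exact: Sigma_stress_field.
exact: moment_stress_field.
Qed.
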